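(* Let $\mathbf{L}\in Q(\mathbb{B}^n)$. If an analytic function $F:\mathbb{B}^n\to\mathbb{C}$ has bounded $\mathbf{L}$-index in joint variables, then there exists $p\in\mathbb{Z}_+$ such that for all $d\in(0,\beta/\sqrt n]$ there exists $\eta(d)\in(0,d)$ such that for each $z^0\in\mathbb{B}^n$ there are $r=r(d,z^0)\in(\eta(d),d)$ and $k^0=k^0(d,z^0)\in\mathbb{Z}_+$ with $k^0\le p$ for which $P_{k^0}$ is a dominating polynomial, on the skeleton $\mathbb{T}^n\left(z^0,\frac{r\mathbf{1}}{\mathbf{L}(z^0)}\right)$, in the power series expansion of $F$ about $z^0$.
   Context: $\mathbb{R}_+=[0,\infty)$, $\mathbb{Z}_+=\{0,1,2,\dots\}$, $\mathbf{1}=(1,\dots,1)$. $|\cdot|$ is the Euclidean norm on $\mathbb{C}^n$ (and on $\mathbb{R}^n$); $\mathbb{B}^n=\{z\in\mathbb{C}^n:|z|<1\}$. For $K\in\mathbb{Z}^n_+$: $\|K\|=k_1+\dots+k_n$, $K!=k_1!\cdots k_n!$, $A^K=a_1^{k_1}\cdots a_n^{k_n}$, and $F^{(K)}=\partial^{\|K\|}F/\partial z_1^{k_1}\cdots\partial z_n^{k_n}$. Quotients $A/B$ of vectors are componentwise. For $R\in\mathbb{R}^n_+$: $\mathbb{D}^n[z^0,R]=\{z:|z_j-z^0_j|\le r_j\ \forall j\}$, $\mathbb{T}^n(z^0,R)=\{z:|z_j-z^0_j|=r_j\ \forall j\}$. Dominating polynomial: for $z^0\in\mathbb{B}^n$ expand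 $F(z)=\sum_{k=0}^\infty P_k(z-z^0)$, $P_k(z-z^0)=\sum_{\|J\|=k}b_J(z-z^0)^J$, $b_J=F^{(J)}(z^0)/J!$. The polynomial $P_{k^0}$ is called a dominating polynomial in this expansion on $\mathbb{T}^n(z^0,R)$ if for every $z\in\mathbb{T}^n(z^0,R)$: $\left|\sum_{k\ne k^0}P_k(z-z^0)\right|\le\frac12\max\{|b_J|R^J:\|J\|=k^0\}$. Fix a constant $\beta>\sqrt n$. Throughout, $\mathbf{L}(z)=(l_1(z),\dots,l_n(z))$, where each $l_j:\mathbb{B}^n\to\mathbb{R}_+$ is continuous and $l_j(z)>\beta/(1-|z|)$ for all $z\in\mathbb{B}^n$. (Then $\mathbb{D}^n[z^0,R/\mathbf{L}(z^0)]\subset\mathbb{B}^n$ whenever $z^0\in\mathbb{B}^n$, $|R|\le\beta$.) $Q(\mathbb{B}^n)$ is the class of such $\mathbf{L}$ satisfying, for all $R\in\mathbb{R}^n_+$ with $|R|\le\beta$ and all $j$, $0<\lambda_{1,j}(R)\le\lambda_{2,j}(R)<\infty$, where $\lambda_{1,j}(R)$ and $\lambda_{2,j}(R)$ are respectively the infimum and the supremum of $l_j(z)/l_j(z^0)$ over all $z^0\in\mathbb{B}^n$ and $z\in\mathbb{D}^n[z^0,R/\mathbf{L}(z^0)]$. An analytic $F:\mathbb{B}^n\to\mathbb{C}$ is of bounded $\mathbf{L}$-index in joint variables if there is $m\in\mathbb{Z}_+$ such that for all $z\in\mathbb{B}^n$ and $J\in\mathbb{Z}^n_+$: $\frac{|F^{(J)}(z)|}{J!\mathbf{L}^J(z)}\le\max\{\frac{|F^{(K)}(z)|}{K!\mathbf{L}^K(z)}:K\in\mathbb{Z}^n_+,\|K\|\le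 m\}$. *)

(* Defs.v *)
From HB Require Import structures.
From mathcomp Require Import all_boot all_order all_algebra.
From mathcomp Require Import all_classical all_reals all_analysis.
From mathcomp Require Export complex.

Set Implicit Arguments.
Unset Strict Implicit.
Unset Printing Implicit Defensive.

Import Order.TTheory GRing.Theory Num.Theory.
Import numFieldNormedType.Exports.

Local Open Scope classical_set_scope.
Local Open Scope ring_scope.
Local Open Scope complex_scope.

(* R[i] gets its topology and normed module structure through R[i]^o.
   The library norm on R[i] has its values in R[i]; [cabs] is the modulus as an
   element of R.  The library norm on 'rV is the max norm, which induces the
   same topology as the Euclidean norms below. *)
Definition cabs (R : realType) (z : R[i]) : R := complex.Re `|z|.

Definition enormC (R : realType) (n : nat) (z : 'rV[R[i]]_n) : R :=
  Num.sqrt (\sum_(j < n) cabs (z 0 j) ^+ 2).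

Definition enormR (R : realType) (n : nat) (x : 'rV[R]_n) : R :=
  Num.sqrt (\sum_(j < n) `|x 0 j| ^+ 2).

Definition cball (R : realType) (n : nat) : set 'rV[R[i]]_n :=
  [set z | enormC z < 1].

Definition vdiv (R : realType) (n : nat) (A B : 'rV[R]_n) : 'rV[R]_n :=
  \row_(j < n) (A 0 j / B 0 j).

Definition polydisc (R : realType) (n : nat)
    (z0 : 'rV[R[i]]_n) (r : 'rV[R]_n) : set 'rV[R[i]]_n :=
  [set z | forall j, cabs (z 0 j - z0 0 j) <= r 0 j].

Definition skeleton (R : realType) (n : nat)
    (z0 : 'rV[R[i]]_n) (r : 'rV[R]_n) : set 'rV[R[i]]_n :=
  [set z | forall j, cabs (z 0 j - z0 0 j) = r 0 j].

(* Multi-indices are functions 'I_n -> nat.  Those of degree at most k have all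
   entries at most k, so they are the J : {ffun 'I_n -> 'I_k.+1} satisfying
   [mdeg (midx J) <= k]; this turns sums and maxima over them into bigops. *)
Definition midx (n k : nat) (J : {ffun 'I_n -> 'I_k.+1}) : 'I_n -> nat :=
  fun j => J j.

Definition mdeg (n : nat) (K : 'I_n -> nat) : nat := (\sum_(j < n) K j)%N.

Definition mfact (n : nat) (K : 'I_n -> nat) : nat := (\prod_(j < n) (K j)`!)%N.

Definition mpow (S : comNzRingType) (n : nat) (A : 'rV[S]_n) (K : 'I_n -> nat)
  : S := \prod_(j < n) A 0 j ^+ K j.

(* The complex partial derivative with respect to z_j.  For points of an open
   set it only depends on the values of F on that set. *)
Definition partial (R : realType) (n : nat) (j : 'I_n)
    (F : 'rV[R[i]]_n -> R[i]) : 'rV[R[i]]_n -> R[i] :=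
  fun z => 'D_(delta_mx 0 j) (F : 'rV[R[i]]_n -> R[i]^o) z.

(* The derivatives in the last variable are taken first, as in
   d^(k_1) / dz_1^(k_1) ( ... d^(k_n) / dz_n^(k_n) F). *)
Definition mderive (R : realType) (n : nat) (K : 'I_n -> nat)
    (F : 'rV[R[i]]_n -> R[i]) : 'rV[R[i]]_n -> R[i] :=
  foldr (fun (j : 'I_n) G => iter (K j) (partial j) G) F (enum 'I_n).

Definition hpart (S : comNzRingType) (n : nat) (c : ('I_n -> nat) -> S)
    (k : nat) (w : 'rV[S]_n) : S :=
  \sum_(J : {ffun 'I_n -> 'I_k.+1} | mdeg (midx J) == k)
    c (midx J) * mpow w (midx J).

(* F is near each point of the ball the sum of an absolutely convergent power
   series; since the convergence is absolute, the terms may be grouped by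
   degree.  Functions on the ball are total functions whose values outside the
   ball are irrelevant (the polydisc can be shrunk to lie inside the ball). *)
Definition analytic_on_ball (R : realType) (n : nat)
    (F : 'rV[R[i]]_n -> R[i]) : Prop :=
  forall z0 : 'rV[R[i]]_n, cball z0 ->
    exists2 rho : R, 0 < rho &
    exists c : ('I_n -> nat) -> R[i],
      forall z : 'rV[R[i]]_n, (forall j, cabs (z 0 j - z0 0 j) < rho) ->
        cvgn (fun N : nat => \sum_(0 <= k < N)
          hpart (fun J => cabs (c J)) k (\row_j cabs (z 0 j - z0 0 j)))
        /\ (fun N : nat => \sum_(0 <= k < N) hpart c k (z - z0) : R[i]^o) @ \oo
             --> (F z : R[i]^o).

Definition tcoef (R : realType) (n : nat) (F : 'rV[R[i]]_n -> R[i])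
    (z0 : 'rV[R[i]]_n) (J : 'I_n -> nat) : R[i] :=
  mderive J F z0 / (mfact J)%:R.

(* The sum over k <> k0 is required to converge.  The maximum is over a nonempty
   set of nonnegative reals for n > 0, so 0 is a harmless default value. *)
Definition dominating (R : realType) (n : nat) (F : 'rV[R[i]]_n -> R[i])
    (z0 : 'rV[R[i]]_n) (r : 'rV[R]_n) (k0 : nat) : Prop :=
  forall z : 'rV[R[i]]_n, skeleton z0 r z ->
    exists2 s : R[i],
      (fun N : nat => \sum_(0 <= k < N | k != k0)
                        hpart (tcoef F z0) k (z - z0) : R[i]^o)
        @ \oo --> (s : R[i]^o) &
      cabs s <= 2^-1 * \big[Num.max/0]_(J : {ffun 'I_n -> 'I_k0.+1}
                                         | mdeg (midx J) == k0)
                         (cabs (tcoef F z0 (midx J)) * mpow r (midx J)).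

(* L z 0 j is l_j(z). *)
Definition ratio_set (R : realType) (n : nat) (L : 'rV[R[i]]_n -> 'rV[R]_n)
    (j : 'I_n) (r : 'rV[R]_n) : set (\bar R) :=
  [set x | exists z0 z : 'rV[R[i]]_n,
     [/\ cball z0, polydisc z0 (vdiv r (L z0)) z
       & x = (L z 0 j / L z0 0 j)%:E]].

Definition lambda1 (R : realType) (n : nat) (L : 'rV[R[i]]_n -> 'rV[R]_n)
  (j : 'I_n) (r : 'rV[R]_n) : \bar R := ereal_inf (ratio_set L j r).

Definition lambda2 (R : realType) (n : nat) (L : 'rV[R[i]]_n -> 'rV[R]_n)
  (j : 'I_n) (r : 'rV[R]_n) : \bar R := ereal_sup (ratio_set L j r).

(* Includes the standing assumptions on L. *)
Definition classQ (R : realType) (n : nat) (beta : R)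
    (L : 'rV[R[i]]_n -> 'rV[R]_n) : Prop :=
  [/\ forall j, {within (@cball R n : set 'rV[R[i]^o]_n),
                   continuous (fun z : 'rV[R[i]^o]_n => L z 0 j)},
      forall z j, cball z -> beta / (1 - enormC z) < L z 0 j
    & forall r : 'rV[R]_n, (forall j, 0 <= r 0 j) -> enormR r <= beta ->
        forall j, [/\ (0 < lambda1 L j r)%E, (lambda1 L j r <= lambda2 L j r)%E
                    & (lambda2 L j r < +oo)%E]].

Definition nderiv (R : realType) (n : nat) (L : 'rV[R[i]]_n -> 'rV[R]_n)
    (F : 'rV[R[i]]_n -> R[i]) (z : 'rV[R[i]]_n) (J : 'I_n -> nat) : R :=
  cabs (mderive J F z) / ((mfact J)%:R * mpow (L z) J).

Definition bounded_Lindex (R : realType) (n : nat)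
    (L : 'rV[R[i]]_n -> 'rV[R]_n) (F : 'rV[R[i]]_n -> R[i]) : Prop :=
  exists m : nat, forall (z : 'rV[R[i]]_n) (J : 'I_n -> nat), cball z ->
    nderiv L F z J <=
      \big[Num.max/0]_(K : {ffun 'I_n -> 'I_m.+1} | (mdeg (midx K) <= m)%N)
        nderiv L F z (midx K).

(* Main.v *)
Require Import Defs.
From mathcomp Require Import all_boot all_order all_algebra.
From mathcomp Require Import all_classical all_reals all_analysis.
From mathcomp Require Import zify ring lra.
Import Order.TTheory GRing.Theory Num.Theory.
Import numFieldNormedType.Exports.
Local Open Scope ring_scope.
Local Open Scope complex_scope.

(** Let a_k be the maximum of |b_J| / L^J(z0) over the multi-indices J of degree
    k.  On the skeleton of radius r 1 / L(z0) every term b_J (z - z0)^J of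
    degree k has modulus at most a_k r^k, so the problem concerns the single
    numerical sequence a.  Bounded index at z0 says that each a_k is at most
    some a_j with j <= m, and p = m works.

    For r <= 1 this makes the largest of the numbers a_k r^k occur at some
    degree at most m, a central index at r ([central_index]).  Along the
    geometric radii r_i = min(d, 1) q^i central indices do not increase, so
    among the first 2m + 3 of them three consecutive ones coincide
    ([monotone_plateau]).  At the middle radius r of these three, comparing
    with the two neighbours gives a_k r^k <= q^|k - k0| a_k0 r^k0 for all k
    ([dominating_radius]): a dominating degree k0, at a radius bounded below
    uniformly in z0.

    There are at most (k + 1)^n <= (2^n)^k monomials of degree k.  With
    q = 1 / (5 (2^n)^(m+1)) this growth is absorbed: the part of degree k <> k0
    has modulus at most 5^-|k - k0| a_k0 r^k0, and these bounds add up to at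
    most a half of a_k0 r^k0 ([sum_pow_gap_le]).  Absolute convergence then
    gives the sum over k <> k0 and the bound on it ([absolute_cvg_complex],
    [dominating_of_gap_decay]). *)

(** * A dominating degree for a numerical sequence *)

(** The distance |k - l|, in a form suited to natural number arithmetic. *)
Definition gap (k l : nat) : nat := ((k - l) + (l - k))%N.

(** Without a plateau f would drop by at least one every two steps, which is
    possible only m times. *)
Lemma monotone_plateau (m : nat) (f : nat -> nat) :
  (forall i, f i.+1 <= f i)%N -> (f 0 <= m)%N ->
  exists2 i, (i <= m.*2)%N & f i = f i.+1 /\ f i.+1 = f i.+2.
Proof.
move=> fdec f0.
case: (pselect (exists2 i, (i <= m.*2)%N & f i = f i.+2)) => [[i im fi]|nofix].
  exists i => //; have := fdec i; have := fdec i.+1; lia.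
suff H j : (j <= m.+1)%N -> (f j.*2 + j <= m)%N.
  by have := H m.+1 (leqnn _); lia.
elim: j => [|j IH] jm; first by rewrite addn0.
have := IH (ltnW jm); rewrite doubleS.
have : f j.*2 <> f j.*2.+2.
  by move=> e; apply: nofix; exists j.*2 => //; rewrite leq_double.
have := fdec j.*2; have := fdec j.*2.+1; lia.
Qed.

(** On each side of k0 lies a part of the geometric series
    1/5 + 1/25 + ... = 1/4; the base 5 is what makes the total a half.  The two
    sides are handled by inductions on bounds sharp enough to reproduce
    themselves. *)
Lemma sum_pow_gap_le (R : realFieldType) (k0 N : nat) :
  \sum_(0 <= k < N | k != k0) (5^-1 : R) ^+ gap k k0 <= 2^-1.
Proof.
pose x : R := 5^-1.
have x0 : 0 < x by rewrite invr_gt0.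
have step e : x ^+ e = 5 * x ^+ e.+1.
  by rewrite exprS mulrA mulfV ?mul1r.
rewrite big_mkcond /=.
have below M : (M <= k0)%N ->
    \sum_(0 <= k < M) (if k != k0 then x ^+ gap k k0 else 0)
      <= 4^-1 * x ^+ (k0 - M).
  elim: M => [|M IH] Mk0.
    by rewrite big_nil mulr_ge0 ?exprn_ge0 ?ltW // invr_gt0.
  rewrite big_nat_recr //=.
  have -> : (M != k0) = true by lia.
  have -> : gap M k0 = (k0 - M.+1).+1 by rewrite /gap; lia.
  have := IH (ltnW Mk0).
  have -> : (k0 - M)%N = (k0 - M.+1).+1 by lia.
  by rewrite (step (k0 - M.+1)%N); lra.
have above j :
    \sum_(0 <= k < k0.+1 + j) (if k != k0 then x ^+ gap k k0 else 0)
      <= 2^-1 - 4^-1 * x ^+ j.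
  elim: j => [|j IH].
    rewrite addn0 big_nat_recr //= eqxx/= expr0 addr0.
    by have := below _ (leqnn k0); rewrite subnn expr0; lra.
  rewrite addnS big_nat_recr //=.
  have -> : (k0.+1 + j)%N != k0 by lia.
  have -> : gap (k0.+1 + j) k0 = j.+1 by rewrite /gap; lia.
  by have := step j; lra.
case: (leqP N k0) => [Nk|kN].
  have := below _ Nk; have : x ^+ (k0 - N) <= 1.
    by rewrite exprn_ile1 ?ltW // /x invf_lt1 // ltr1n.
  by lra.
have := above (N - k0.+1)%N; rewrite subnKC //.
have : 0 < x ^+ (N - k0.+1) by rewrite exprn_gt0.
by lra.
Qed.

(** For k > m, passing from a_k to some a_j with j <= m also improves the power
    of r, because r <= 1. *)
Lemma central_index (R : realFieldType) (a : nat -> R) (m : nat) (r : R) :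
  (forall k, 0 <= a k) -> (forall k, exists2 j, (j <= m)%N & a k <= a j) ->
  0 <= r <= 1 ->
  exists k0, (k0 <= m)%N /\ forall k, a k * r ^+ k <= a k0 * r ^+ k0.
Proof.
move=> a0 am /andP[r0 r1].
have [/= k0 _ kmax] := @arg_maxP _ R _ (@ord0 m) xpredT
  (fun k : 'I_m.+1 => a k * r ^+ k) isT.
have low j : (j <= m)%N -> a j * r ^+ j <= a k0 * r ^+ k0.
  by move=> jm; apply: (kmax (Ordinal (jm : (j < m.+1)%N)) isT).
exists k0; split=> [|k]; first by rewrite -ltnS ltn_ord.
case: (leqP k m) => [/low//|mk].
have [j jm akj] := am k; apply: le_trans (low j jm).
apply: ler_pM; rewrite ?exprn_ge0 // ler_wiXn2l //.
by rewrite ltnW // (leq_ltn_trans jm).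
Qed.

(** The bound on i is what bounds the radius away from 0 in terms of q, d and m
    alone. *)
Lemma dominating_radius (R : realType) (a : nat -> R) (m : nat) (q d : R) :
  (forall k, 0 <= a k) -> (forall k, exists2 j, (j <= m)%N & a k <= a j) ->
  0 < q < 1 -> 0 < d <= 1 ->
  exists i k0, [/\ (i <= m.*2)%N, (k0 <= m)%N &
    forall k, a k * (d * q ^+ i.+1) ^+ k
              <= q ^+ gap k k0 * (a k0 * (d * q ^+ i.+1) ^+ k0)].
Proof.
move=> a0 am /andP[q0 q1] /andP[d0 d1].
pose rho i := d * q ^+ i.
have rhoS i : rho i.+1 = rho i * q by rewrite /rho exprSr mulrA.
have rho_gt0 i : 0 < rho i by rewrite mulr_gt0 ?exprn_gt0.
have rho_le1 i : rho i <= 1.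
  by rewrite mulr_ile1 ?exprn_ge0 ?exprn_ile1 // ltW.
have /choice[f fP] : forall i, exists k0,
    (k0 <= m)%N /\ forall k, a k * rho i ^+ k <= a k0 * rho i ^+ k0.
  by move=> i; apply: central_index => //; rewrite ltW ?rho_le1.
(* For a = 0 the chosen central indices are arbitrary and need not decrease. *)
case: (pselect (exists k, 0 < a k)) => [[k1 ak1]|a_eq0]; last first.
  have {}a_eq0 k : a k = 0.
    apply/eqP; rewrite eq_le a0 andbT leNgt.
    by apply/negP => ak; apply: a_eq0; exists k.
  by exists 0%N, 0%N; split=> // k; rewrite !a_eq0 !mul0r mulr0.
(* Maximality of f(i+1) at the smaller radius and of f(i) at the larger one give
   q^f(i) <= q^f(i+1); as q < 1, f decreases however ties were broken. *)
have fdec i : (f i.+1 <= f i)%N.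
  have [_ /(_ (f i.+1)) big_i] := fP i.
  have [_ /(_ (f i)) big_Si] := fP i.+1.
  have pos : 0 < a (f i) * rho i ^+ f i.
    have [_ /(_ k1)] := fP i; apply: lt_le_trans.
    by rewrite mulr_gt0 ?exprn_gt0.
  rewrite -(ler_iXn2l q0 q1) -(ler_pM2l pos).
  move: big_Si; rewrite rhoS !(exprMn _ (rho i) q) !mulrA => /le_trans; apply.
  by rewrite ler_wpM2r ?exprn_ge0 // ltW.
have [i im [fi fSi]] := monotone_plateau m f fdec (fP 0%N).1.
exists i, (f i.+1); split=> // [|k]; first exact: (fP i.+1).1.
rewrite -/(rho i.+1) /gap.
have qk_gt0 e : 0 < q ^+ e by rewrite exprn_gt0.
(* With k0 the common value, the terms of index k and k0 are compared at the
   larger radius when k >= k0 and at the smaller one when k < k0; moving to the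
   middle radius gains q^|k - k0|. *)
case: (leqP (f i.+1) k) => [fk|kf].
  have [_ /(_ k)] := fP i; rewrite fi rhoS !(exprMn _ (rho i) q) => big_k.
  have -> : (f i.+1 - k = 0)%N by lia.
  have -> : q ^+ k = q ^+ (k - f i.+1) * q ^+ f i.+1 by rewrite -exprD subnK.
  rewrite addn0.
  move: (f i.+1) big_k (k - f i.+1)%N => k0 big_k e.
  rewrite -(ler_pM2r (mulr_gt0 (qk_gt0 e) (qk_gt0 k0))) in big_k.
  by lra.
have [_ /(_ k)] := fP i.+2; rewrite -fSi (rhoS i.+1).
rewrite !(exprMn _ (rho i.+1) q) => big_k.
have -> : (k - f i.+1 = 0)%N by lia.
rewrite add0n -(ler_pM2r (qk_gt0 k)) -mulrA.
apply: le_trans big_k _.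
have -> : q ^+ f i.+1 = q ^+ (f i.+1 - k) * q ^+ k.
  by rewrite -exprD subnK // ltnW.
lra.
Qed.

(** * Absolutely convergent complex series *)

Section modulus.
Context {R : realType}.
Implicit Types z w : R[i].

Lemma cabsC z : (cabs z)%:C = `|z|. Proof. by []. Qed.

Lemma cabsM z w : cabs (z * w) = cabs z * cabs w.
Proof. by apply: complexI; rewrite rmorphM !cabsC normrM. Qed.

Lemma cabs1 : cabs (1 : R[i]) = 1.
Proof. by apply: complexI; rewrite cabsC normr1. Qed.

Lemma cabsX z k : cabs (z ^+ k) = cabs z ^+ k.
Proof. by apply: complexI; rewrite rmorphXn !cabsC normrX. Qed.

Lemma cabs_divn z k : cabs (z / k%:R) = cabs z / k%:R.
Proof.
apply: complexI; rewrite rmorphM fmorphV rmorph_nat !cabsC.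
by rewrite normrM normfV normr_nat.
Qed.

Lemma cabsD z w : cabs (z + w) <= cabs z + cabs w.
Proof. by rewrite -lecR rmorphD !cabsC ler_normD. Qed.

Lemma cabs_sum (I : Type) (s : seq I) (P : pred I) (f : I -> R[i]) :
  cabs (\sum_(i <- s | P i) f i) <= \sum_(i <- s | P i) cabs (f i).
Proof.
elim/big_rec2: _ => [|i x y _ xy]; first by rewrite -lecR cabsC normr0.
by apply: le_trans (cabsD _ _) _; rewrite lerD2l.
Qed.

Lemma cabs_Re z : `|complex.Re z| <= cabs z.
Proof. by rewrite -lecR normc_ge_Re. Qed.

Lemma cabs_Im z : `|complex.Im z| <= cabs z.
Proof.
case: z => x y; rewrite /cabs /= -sqrtr_sqr ler_wsqrtr // lerDr sqr_ge0 //.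
Qed.

Lemma cabs_le_ReIm z : cabs z <= `|complex.Re z| + `|complex.Im z|.
Proof.
case: z => x y.
rewrite /cabs /= -[leRHS]ger0_norm ?addr_ge0 // -sqrtr_sqr ler_wsqrtr //.
have := mulr_ge0 (normr_ge0 x) (normr_ge0 y).
by rewrite sqrrD !real_normK ?num_real //; lra.
Qed.

Lemma bounded_sums_is_cvgn (u : nat -> R) (M : R) :
  (forall N, \sum_(0 <= k < N) `|u k| <= M) -> cvgn (series u).
Proof.
move=> uM; apply: normed_cvg; apply: nondecreasing_is_cvgn.
  by apply: nondecreasing_series => i _ _; exact: normr_ge0.
by exists M => _ [N _ <-]; exact: uM.
Qed.

(** The real and imaginary parts converge absolutely in R; the bound passes to
    the limit. *)
Lemma absolute_cvg_complex (u : nat -> R[i]) (M : R) :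
  (forall N, \sum_(0 <= k < N) cabs (u k) <= M) ->
  exists2 s : R[i],
    ((fun N => \sum_(0 <= k < N) u k : R[i]^o) @ \oo --> (s : R[i]^o))%classic &
    cabs s <= M.
Proof.
move=> uM.
pose re k := complex.Re (u k); pose im k := complex.Im (u k).
have cvRe : cvgn (series re).
  apply: (@bounded_sums_is_cvgn _ M) => N; apply: le_trans (uM N).
  by apply: ler_sum => k _; exact: cabs_Re.
have cvIm : cvgn (series im).
  apply: (@bounded_sums_is_cvgn _ M) => N; apply: le_trans (uM N).
  by apply: ler_sum => k _; exact: cabs_Im.
pose x := limn (series re).
pose y := limn (series im).
have ReS N : complex.Re (\sum_(0 <= k < N) u k) = series re N.
  rewrite /series /=; elim: N => [|N IH]; first by rewrite !big_nil.
  rewrite !big_nat_recr //= -IH /re.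
  by case: (\sum_(0 <= k < N) u k) (u N) => [? ?] [].
have ImS N : complex.Im (\sum_(0 <= k < N) u k) = series im N.
  rewrite /series /=; elim: N => [|N IH]; first by rewrite !big_nil.
  rewrite !big_nat_recr //= -IH /im.
  by case: (\sum_(0 <= k < N) u k) (u N) => [? ?] [].
have close (e : R) : 0 < e ->
    (\forall N \near \oo, cabs ((x +i* y) - \sum_(0 <= k < N) u k) < e)%classic.
  move=> e0; have e2 : 0 < e / 2 by rewrite divr_gt0.
  have /cvgrPdist_lt/(_ _ e2) nRe := cvRe.
  have /cvgrPdist_lt/(_ _ e2) nIm := cvIm.
  near=> N; apply: le_lt_trans (cabs_le_ReIm _) _.
  rewrite [e]splitr ltrD //.
    have -> : complex.Re ((x +i* y) - \sum_(0 <= k < N) u k)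
      = x - series re N by rewrite -ReS; case: (\sum_(0 <= k < N) u k).
    by near: N.
  have -> : complex.Im ((x +i* y) - \sum_(0 <= k < N) u k)
    = y - series im N by rewrite -ImS; case: (\sum_(0 <= k < N) u k).
  by near: N.
exists (x +i* y).
  (* In R[i], a positive e is a real number. *)
  apply/cvgrPdist_lt => e; rewrite ltcE /= => /andP[/eqP e_real e0].
  apply: filterS (close _ e0) => N.
  by rewrite -ltcR cabsC; case: e e_real {e0} => a b /= ->.
apply/ler_addgt0Pr => e e0.
have [N _ /(_ N (leqnn N)) sN] := close e e0.
pose S := \sum_(0 <= k < N) u k.
have -> : x +i* y = S + ((x +i* y) - S) by rewrite addrC subrK.
apply: le_trans (cabsD _ _) _; rewrite lerD ?(ltW sN) //.
by apply: le_trans (uM N); exact: cabs_sum.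
Unshelve. all: by end_near.
Qed.

End modulus.

(** * Homogeneous parts on a skeleton *)

Lemma midx_onto (n k : nat) (J : 'I_n -> nat) :
  mdeg J = k -> exists J' : {ffun 'I_n -> 'I_k.+1}, midx J' = J.
Proof.
move=> Jk; exists [ffun j => inord (J j)]; apply/funext => j.
rewrite /midx ffunE inordK // ltnS -Jk /mdeg.
by rewrite (bigD1 j) //= leq_addr.
Qed.

(** A crude bound, chosen because it is geometric in k and so can be absorbed by
    the geometric decay q^|k - k0|. *)
Lemma card_homogeneous_le (n k : nat) :
  (#|[pred J : {ffun 'I_n -> 'I_k.+1} | mdeg (midx J) == k]| <= (2 ^ n) ^ k)%N.
Proof.
apply: leq_trans (max_card _) _.
rewrite card_ffun !card_ord -expnM mulnC expnM.
by case: n => [|n'] //; rewrite leq_exp2r // ltn_expl.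
Qed.

Lemma cabs_hpart_le (R : realType) (n : nat) (c : ('I_n -> nat) -> R[i])
    (r : 'rV[R]_n) (w : 'rV[R[i]]_n) (k : nat) :
  (forall j, cabs (w 0 j) = r 0 j) ->
  cabs (hpart c k w) <= (2 ^+ n) ^+ k *
    \big[Num.max/0]_(J : {ffun 'I_n -> 'I_k.+1} | mdeg (midx J) == k)
      (cabs (c (midx J)) * mpow r (midx J)).
Proof.
move=> wr; set M := \big[_/_]_(_ | _) _.
have M0 : 0 <= M by exact: bigmax_ge_id.
apply: le_trans (cabs_sum _ _ _ _) _.
apply: (@le_trans _ _
  (\sum_(J : {ffun 'I_n -> 'I_k.+1} | mdeg (midx J) == k) M)).
  apply: ler_sum => J Jk; rewrite cabsM.
  have -> : cabs (mpow w (midx J)) = mpow r (midx J).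
    rewrite /mpow (big_morph _ (@cabsM R) (@cabs1 R)).
    by apply: eq_bigr => j _; rewrite cabsX wr.
  exact: (le_bigmax_cond 0
    (fun J : {ffun 'I_n -> 'I_k.+1} => cabs (c (midx J)) * mpow r (midx J)) Jk).
rewrite sumr_const -[leLHS]mulr_natl ler_wpM2r //.
by rewrite -!natrX ler_nat card_homogeneous_le.
Qed.

(** * Reduction to the sequence of degree weights *)

Section weights.
Context {R : realType} {n : nat} (L : 'rV[R[i]]_n -> 'rV[R]_n)
  (F : 'rV[R[i]]_n -> R[i]) (z0 : 'rV[R[i]]_n).

(** This is the a_k above: nderiv L F z0 J is |b_J| / L^J(z0). *)
Definition degree_weight (k : nat) : R :=
  \big[Num.max/0]_(J : {ffun 'I_n -> 'I_k.+1} | mdeg (midx J) == k)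
    nderiv L F z0 (midx J).

Lemma degree_weight_ge0 k : 0 <= degree_weight k.
Proof. exact: bigmax_ge_id. Qed.

Lemma nderiv_le_weight k (J : 'I_n -> nat) :
  mdeg J = k -> nderiv L F z0 J <= degree_weight k.
Proof.
move=> Jk; have [J' J'J] := midx_onto _ _ _ Jk; rewrite -J'J.
apply: (le_bigmax_cond 0
  (fun J : {ffun 'I_n -> 'I_k.+1} => nderiv L F z0 (midx J))).
by rewrite J'J Jk.
Qed.

Lemma scaled_mpow r (J : 'I_n -> nat) :
  mpow (vdiv (r *: const_mx 1) (L z0)) J = r ^+ mdeg J / mpow (L z0) J.
Proof.
rewrite /mpow /mdeg -prodrXr -prodf_div; apply: eq_bigr => j _.
by rewrite !mxE mulr1 expr_div_n.
Qed.

Lemma weighted_coef r (J : 'I_n -> nat) :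
  cabs (tcoef F z0 J) * mpow (vdiv (r *: const_mx 1) (L z0)) J
  = nderiv L F z0 J * r ^+ mdeg J.
Proof.
rewrite scaled_mpow /tcoef /nderiv cabs_divn invfM mulrA -!mulrA.
by congr (_ * (_ * _)); rewrite mulrC.
Qed.

(** By homogeneity, the maximum in the definition of a dominating polynomial is
    a_k r^k; this reduces the problem to the sequence a. *)
Lemma max_coef_on_skeleton r k : 0 <= r ->
  \big[Num.max/0]_(J : {ffun 'I_n -> 'I_k.+1} | mdeg (midx J) == k)
    (cabs (tcoef F z0 (midx J)) * mpow (vdiv (r *: const_mx 1) (L z0)) (midx J))
  = degree_weight k * r ^+ k.
Proof.
move=> r0.
rewrite /degree_weight (big_morph (fun x => x * r ^+ k)
  (id1 := 0) (op1 := Num.max)); first last.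
- by rewrite mul0r.
- by move=> x y; rewrite maxr_pMl ?exprn_ge0.
by apply: eq_bigr => J /eqP Jk; rewrite weighted_coef Jk.
Qed.

(** Bounded index at z0, in terms of the sequence a. *)
Lemma low_degree_weight m :
  (forall J : 'I_n -> nat, nderiv L F z0 J <=
    \big[Num.max/0]_(K : {ffun 'I_n -> 'I_m.+1} | (mdeg (midx K) <= m)%N)
      nderiv L F z0 (midx K)) ->
  forall k, exists2 j, (j <= m)%N & degree_weight k <= degree_weight j.
Proof.
move=> Fm k.
have [/= j _ jmax] := @arg_maxP _ R _ (@ord0 m) xpredT
  (fun i : 'I_m.+1 => degree_weight i) isT.
exists j; first by rewrite -ltnS ltn_ord.
apply: bigmax_le => [|J _]; first exact: degree_weight_ge0.
apply: le_trans (Fm _) _; apply: bigmax_le => [|K Km].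
  exact: degree_weight_ge0.
apply: le_trans (nderiv_le_weight _ _ erefl) _.
exact: (jmax (Ordinal (Km : (mdeg (midx K) < m.+1)%N)) isT).
Qed.

End weights.

(** * The dominating polynomial *)

(** The factor (2^n)^k from counting monomials is at most (2^n)^((m+1)|k - k0|)
    for k <> k0, since k <= m + |k - k0| <= (m+1)|k - k0|; this is the reason
    for the exponent m+1 in q. *)
Lemma dominating_of_gap_decay (R : realType) (n m k0 : nat)
    (L : 'rV[R[i]]_n -> 'rV[R]_n) (F : 'rV[R[i]]_n -> R[i])
    (z0 : 'rV[R[i]]_n) (r : R) (q := 5^-1 * (2 ^+ n) ^- m.+1 : R) :
  0 <= r -> (k0 <= m)%N ->
  (forall k, degree_weight L F z0 k * r ^+ k
             <= q ^+ gap k k0 * (degree_weight L F z0 k0 * r ^+ k0)) ->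
  dominating F z0 (vdiv (r *: const_mx 1) (L z0)) k0.
Proof.
move=> r0 k0m decay z zT; rewrite max_coef_on_skeleton //.
set M := degree_weight L F z0 k0 * r ^+ k0.
have M0 : 0 <= M by rewrite mulr_ge0 ?degree_weight_ge0 ?exprn_ge0.
pose u k := if k != k0 then hpart (tcoef F z0) k (z - z0) else 0.
have small k : k != k0 ->
    cabs (hpart (tcoef F z0) k (z - z0)) <= 5^-1 ^+ gap k k0 * M.
  move=> kk0.
  apply: le_trans (cabs_hpart_le _ _ _ (vdiv (r *: const_mx 1) (L z0)) _ _ _) _.
    by move=> j; rewrite -zT !mxE.
  rewrite max_coef_on_skeleton //.
  have B0 : 0 < (2 ^+ n : R) by rewrite exprn_gt0.
  have B1 : 1 <= (2 ^+ n : R) by rewrite exprn_ege1 // ler1n.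
  apply: le_trans (ler_wpM2l (exprn_ge0 _ (ltW B0)) (decay k)) _.
  rewrite -/M mulrA ler_wpM2r // exprMn mulrCA -[leRHS]mulr1.
  rewrite ler_wpM2l ?exprn_ge0 ?invr_ge0 // exprVn -[(_ ^+ m.+1) ^+ _]exprM.
  by rewrite ler_pdivrMr ?exprn_gt0 // mul1r ler_weXn2l // /gap; nia.
have [N|s us sM] := absolute_cvg_complex u (2^-1 * M).
  apply: le_trans (ler_wpM2r M0 (sum_pow_gap_le R k0 N)).
  rewrite [X in _ <= X * _]big_mkcond /= mulr_suml; apply: ler_sum => k _.
  rewrite /u; case: ifPn => [/small//|_].
  by rewrite mul0r -lecR cabsC normr0.
exists s => //; rewrite (_ : (fun N => _) = fun N => \sum_(0 <= k < N) u k) //.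
by apply/funext => N; rewrite big_mkcond.
Qed.

Theorem theorem11 (R : realType) (n : nat) (beta : R)
    (L : 'rV[R[i]]_n -> 'rV[R]_n) (F : 'rV[R[i]]_n -> R[i])
    (n_gt0 : (0 < n)%N) (beta_gt : Num.sqrt n%:R < beta)
    (LQ : classQ beta L) (Fan : analytic_on_ball F)
    (Fidx : bounded_Lindex L F) :
  exists p : nat,
    forall d : R, 0 < d -> d <= beta / Num.sqrt n%:R ->
    exists eta : R, 0 < eta /\ eta < d /\
      forall z0 : 'rV[R[i]]_n, cball z0 ->
      exists (r : R) (k0 : nat),
        eta < r /\ r < d /\ (k0 <= p)%N /\
        dominating F z0 (vdiv (r *: const_mx 1) (L z0)) k0.
Proof.
have [m Fm] := Fidx.
exists m => d d0 _.
pose q : R := 5^-1 * (2 ^+ n) ^- m.+1.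
have q0 : 0 < q by rewrite mulr_gt0 ?invr_gt0 ?exprn_gt0.
have q1 : q < 1.
  have B1 : 1 <= ((2 ^+ n) ^+ m.+1 : R) by rewrite !exprn_ege1 // ler1n.
  by rewrite /q -invfM invf_lt1 ?mulr_gt0 ?exprn_gt0 //; lra.
(* Central indices of degree at most m require radii at most 1, whereas d may
   exceed 1. *)
pose d1 := Num.min d 1.
have d1_gt0 : 0 < d1 by rewrite lt_min d0 ltr01.
have d1d : d1 <= d by rewrite ge_min lexx.
have radius_lt_d i : d1 * q ^+ i.+1 < d.
  apply: lt_le_trans d1d; rewrite -[ltRHS]mulr1 ltr_pM2l //.
  by rewrite exprn_ilt1 // ltW.
(* The radii are d1 q^(i+1) with i <= 2m, hence all above d1 q^(2m+2). *)
exists (d1 * q ^+ m.*2.+2); split; first by rewrite mulr_gt0 ?exprn_gt0.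
split=> // z0 z0B.
have d1_01 : 0 < d1 <= 1 by rewrite d1_gt0 ge_min lexx orbT.
have q_01 : 0 < q < 1 by rewrite q0.
have [i [k0 [im k0m decay]]] := dominating_radius _ _ m q d1
  (degree_weight_ge0 L F z0) (low_degree_weight _ _ _ m (fun J => Fm z0 J z0B))
  q_01 d1_01.
exists (d1 * q ^+ i.+1), k0; do !split=> //.
  by rewrite ltr_pM2l // ltr_iXn2l.
apply: (@dominating_of_gap_decay _ _ m) => //.
by rewrite mulr_ge0 ?exprn_ge0 ?ltW.
Qed.
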